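(* Let the problem $\min_{\mathbf{x}\in\mathcal{X}} f(\mathbf{x})$ s.t. $g(\mathbf{x})\le 0$ satisfy assumptions A--F of the context for a given $\epsilon>0$. (i) Let $\hat\rho>\rho$, $\hat\epsilon>0$, let $\mathbf{x}_t\in\mathcal{X}$ be such that the subproblem at $\mathbf{x}_t$ is feasible, let $\widehat{\mathbf{x}}_t$ be its solution, and let $\mathbf{x}_{t+1}$ be the output of the switching subgradient method described in the context. Then, deterministically, $$F(\mathbf{x}_{t+1})-F(\widehat{\mathbf{x}}_t)\le\hat\epsilon^2\qquad\text{and}\qquad G(\mathbf{x}_{t+1})\le\hat\epsilon^2,$$ so the switching subgradient method can be used as an oracle $\mathcal{A}$ for the subproblem in the IQRC method. (ii) Consequently, for $\hat\rho\in(\rho,\rho+\rho_\epsilon]$, the complexity (total number of switching subgradient iterations) of the IQRC method using the switching subgradient method as oracle, for obtaining $\mathbb{E}_R\|\mathbf{x}_R-\widehat{\mathbf{x}}_R\|^2\le\epsilon^2$ (nearly $\epsilon$-stationarity), is $O(1/\epsilon^4)$, where all of $\rho,\hat\rho,M,D,\sigma_\epsilon$ and $f(\mathbf{x}_0)-f_{\mathrm{lb}}$ are treated as constants.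
   Context: $\|\cdot\|$ is the Euclidean norm. For $h:\mathbb{R}^d\to\mathbb{R}\cup\{+\infty\}$, the subdifferential is $\partial h(\mathbf{x})=\{\boldsymbol\zeta\in\mathbb{R}^d : h(\mathbf{x}')\ge h(\mathbf{x})+\boldsymbol\zeta^\top(\mathbf{x}'-\mathbf{x})+o(\|\mathbf{x}'-\mathbf{x}\|),\ \mathbf{x}'\to\mathbf{x}\}$. For $\rho\ge 0$, $h$ is $\rho$-weakly convex on $\mathcal{X}$ if $h(\mathbf{x})\ge h(\mathbf{x}')+\boldsymbol\zeta^\top(\mathbf{x}-\mathbf{x}')-\frac{\rho}{2}\|\mathbf{x}-\mathbf{x}'\|^2$ for all $\mathbf{x},\mathbf{x}'\in\mathcal{X}$ and $\boldsymbol\zeta\in\partial h(\mathbf{x}')$. Problem: $\mathcal{X}\subset\mathbb{R}^d$ is a compact convex set, $f_0,\dots,f_m$ are functions, $f\equiv f_0$, $g\equiv\max_{i=1,\dots,m}f_i$; the problem is $\min_{\mathbf{x}\in\mathcal{X}}f(\mathbf{x})$ s.t. $g(\mathbf{x})\le0$. A point $\mathbf{x}$ is $\varepsilon$-feasible if $\mathbf{x}\in\mathcal{X}$ and $g(\mathbf{x})\le\varepsilon$. Subgradients of all $f_i$ can be computed exactly at any point of $\mathcal{X}$. Assumptions (for a given $\epsilon>0$): A. Each $f_i$, $i=0,\dots,m$, is closed and $\rho$-weakly convex on $\mathcal{X}$, with $\partial f_i(\mathbf{x})\ne\emptyset$ for every $\mathbf{x}\in\mathcal{X}$. B. (Uniform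 Slater's condition) There are constants $\sigma_\epsilon>0$, $\rho_\epsilon>0$ such that $\min_{\mathbf{y}\in\mathcal{X}}\{g(\mathbf{y})+\frac{\rho+\rho_\epsilon}{2}\|\mathbf{y}-\mathbf{x}\|^2\}<-\sigma_\epsilon$ for every $\epsilon^2$-feasible $\mathbf{x}$. C. $\max_{\mathbf{x},\mathbf{x}'\in\mathcal{X}}\|\mathbf{x}-\mathbf{x}'\|\le D$. D. $f_{\mathrm{lb}}\equiv\min_{\mathbf{x}\in\mathcal{X}}f(\mathbf{x})>-\infty$. E. An $\epsilon^2$-feasible point $\mathbf{x}_{\mathrm{feas}}$ is available. F. $\|\boldsymbol\zeta\|\le M$ for all $\boldsymbol\zeta\in\partial f_i(\mathbf{x})$, $\mathbf{x}\in\mathcal{X}$, $i=0,\dots,m$. Subproblem at $\mathbf{x}_t\in\mathcal{X}$: put $F(\mathbf{x})=f(\mathbf{x})+\frac{\hat\rho}{2}\|\mathbf{x}-\mathbf{x}_t\|^2$ and $G(\mathbf{x})=g(\mathbf{x})+\frac{\hat\rho}{2}\|\mathbf{x}-\mathbf{x}_t\|^2$; then $\widehat{\mathbf{x}}_t\equiv\arg\min_{\mathbf{y}\in\mathcal{X}}\{F(\mathbf{y})\ \text{s.t.}\ G(\mathbf{y})\le0\}$. $F'(\mathbf{x})$, $G'(\mathbf{x})$ denote any subgradients of $F$, $G$ at $\mathbf{x}$; for $\mathbf{x}\in\mathcal{X}$ they satisfy $\|F'(\mathbf{x})\|\le M+\hat\rho D$ and $\|G'(\mathbf{x})\|\le M+\hat\rho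 D$. Switching subgradient method (input $\mathbf{z}_0=\mathbf{x}_t$, $\hat\rho>\rho$, $\hat\epsilon>0$): set $I=\emptyset$ and $K=\lceil 4(M^2+\hat\rho^2D^2)/((\hat\rho-\rho)\hat\epsilon^2)\rceil$. For $k=0,\dots,K-1$: let $\gamma_k=\frac{2}{(\hat\rho-\rho)(k+2)}$; if $G(\mathbf{z}_k)\le\hat\epsilon^2$, add $k$ to $I$ and set $\mathbf{z}_{k+1}=\mathrm{Proj}_{\mathcal{X}}(\mathbf{z}_k-\gamma_kF'(\mathbf{z}_k))$; otherwise set $\mathbf{z}_{k+1}=\mathrm{Proj}_{\mathcal{X}}(\mathbf{z}_k-\gamma_kG'(\mathbf{z}_k))$. Here $\mathrm{Proj}_{\mathcal{X}}$ is Euclidean projection. Output $\mathbf{x}_{t+1}=\frac{\sum_{k\in I}(k+1)\mathbf{z}_k}{\sum_{k\in I}(k+1)}$. Oracle: a (possibly randomized) algorithm $\mathcal{A}$ such that for any $\hat\epsilon>0$, $\delta'\in(0,1)$ and $\mathbf{x}_t\in\mathcal{X}$ (with feasible subproblem) its output $\mathbf{x}_{t+1}=\mathcal{A}(\mathbf{x}_t,\hat\rho,\hat\epsilon,\delta')\in\mathcal{X}$ satisfies $F(\mathbf{x}_{t+1})-F(\widehat{\mathbf{x}}_t)\le\hat\epsilon^2$ and $G(\mathbf{x}_{t+1})\le\hat\epsilon^2$ with probability at least $1-\delta'$. IQRC method: input $\mathbf{x}_0=\mathbf{x}_{\mathrm{feas}}$, $\hat\rho>\rho$, $\delta\in(0,1)$,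 number of iterations $T$, oracle $\mathcal{A}$, and $$\hat\epsilon=\min\Big\{1,\ \sqrt{\tfrac{\hat\rho-\rho}{4}}\Big(\tfrac{M+\hat\rho D}{\sqrt{2\sigma_\epsilon(\hat\rho-\rho)}}+1\Big)^{-1/2}\Big\}\,\epsilon .$$ For $t=0,\dots,T-1$ set $\mathbf{x}_{t+1}=\mathcal{A}(\mathbf{x}_t,\hat\rho,\hat\epsilon,\delta/T)$. Output $\mathbf{x}_R$ with $R$ uniformly random on $\{0,\dots,T-1\}$. The number of iterations is taken to be the smallest positive integer $T\ge\frac{4(f(\mathbf{x}_0)-f_{\mathrm{lb}})}{\epsilon^2(\hat\rho-\rho)}$, and the complexity is the product $TK$. $\mathbb{E}_R$ is the expectation over $R$ only.
   Formalization: In (ii), E_R‖x_R − x̂_R‖² ≤ ε² is proved for f(x_0) > f_lb and ε below a threshold depending only on the constants, or for any ε if x_0 is ε̂²-feasible, as it can fail for merely ε²-feasible x_0 (e.g. f(x_0) = f_lb, T = 1); TK ≤ C/ε⁴ is for small ε; the case M = D = 0 (K = 0) is excluded. *)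

(* Defs.v *)
From HB Require Import structures.
From mathcomp Require Export all_boot all_order all_algebra.
From mathcomp Require Export all_classical all_reals all_analysis.

Set Implicit Arguments.
Unset Strict Implicit.
Unset Printing Implicit Defensive.

Export Order.TTheory GRing.Theory Num.Theory.
Export numFieldNormedType.Exports.

Local Open Scope classical_set_scope.
Local Open Scope ring_scope.

Section Euclidean.
Context {R : realType} {d : nat}.
Implicit Types (x y c u v : 'rV[R]_d) (X : set 'rV[R]_d) (h : 'rV[R]_d -> \bar R).

Definition dot u v : R := \sum_(i < d) u 0 i * v 0 i.

(* The library's norm `|v| on 'rV[R]_d is the sup norm; it is used here only
   through the topology, which is the Euclidean one. *)
Definition enorm v : R := Num.sqrt (dot v v).

(* Subdifferential of an extended-valued function; by convention it is empty
   at the points where h is not finite. *)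
Definition subdiff h x : set 'rV[R]_d :=
  [set zeta | h x \is a fin_num /\
    exists2 r : 'rV[R]_d -> R^o,
      r =o_x (fun x' => enorm (x' - x) : R^o) &
      \forall x' \near x,
        (h x + (dot zeta (x' - x) + r x')%:E <= h x')%E].

Definition weakly_convex_on (rho : R) X h : Prop :=
  forall x x' zeta, X x -> X x' -> subdiff h x' zeta ->
    (h x' + (dot zeta (x - x') - rho / 2 * enorm (x - x') ^+ 2)%:E <= h x)%E.

(* Closedness of the restriction of h to X: its epigraph is closed. *)
Definition closed_fun_on X h : Prop :=
  closed [set p : 'rV[R]_d * R | X p.1 /\ (h p.1 <= p.2%:E)%E].

Definition proj X x : 'rV[R]_d :=
  [get p | X p /\ forall y, X y -> enorm (x - p) <= enorm (x - y)].

Definition add_quad (a : R) c h x : \bar R :=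
  (h x + (a / 2 * enorm (x - c) ^+ 2)%:E)%E.

End Euclidean.

Section Problem.
Context {R : realType} {d m : nat}.
Variables (X : set 'rV[R]_d) (f : 'I_m.+1 -> 'rV[R]_d -> \bar R).
Implicit Types x y : 'rV[R]_d.

Definition obj x : \bar R := f ord0 x.

(* The maximum over the indices 1, ..., m; -oo is only the neutral element. *)
Definition constr x : \bar R := \big[maxe/-oo%E]_(i < m) f (lift ord0 i) x.

Definition eps_feasible (eps : R) x : Prop := X x /\ (constr x <= eps%:E)%E.

Record assumptions (eps rho rhoeps sigma M D flb : R) (xfeas : 'rV[R]_d) : Prop :=
  Assumptions {
  eps_gt0 : 0 < eps;
  rho_ge0 : 0 <= rho;
  ncons_gt0 : (0 < m)%N;
  X_compact : compact X;
  X_convex : convex_set X;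
  f_gtNy : forall i x, (-oo < f i x)%E;
  f_closed : forall i, closed_fun_on X (f i);
  f_weakly_convex : forall i, weakly_convex_on rho X (f i);
  f_subdiff_neq0 : forall i x, X x -> subdiff (f i) x !=set0;
  sigma_gt0 : 0 < sigma;
  rhoeps_gt0 : 0 < rhoeps;
  slater : forall x, eps_feasible (eps ^+ 2) x ->
    (ereal_inf [set add_quad (rho + rhoeps) x constr y | y in X]
       < (- sigma)%:E)%E;
  X_diam : forall x x', X x -> X x' -> enorm (x - x') <= D;
  flb_lower : forall x, X x -> (flb%:E <= obj x)%E;
  flb_attained : exists2 x, X x & obj x = flb%:E;
  xfeas_feasible : eps_feasible (eps ^+ 2) xfeas;
  subgrad_bound : forall i x zeta, X x -> subdiff (f i) x zeta ->
    enorm zeta <= M }.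

Section Subproblem.
Variables (rhohat : R) (xt : 'rV[R]_d).

Definition subF : 'rV[R]_d -> \bar R := add_quad rhohat xt obj.
Definition subG : 'rV[R]_d -> \bar R := add_quad rhohat xt constr.

Definition sub_feasible : Prop := exists2 y, X y & (subG y <= 0)%E.

Definition xhat : 'rV[R]_d :=
  [get y | [/\ X y, (subG y <= 0)%E &
    forall y', X y' -> (subG y' <= 0)%E -> (subF y <= subF y')%E]].

Definition good_output (e : R) y : Prop :=
  (subF y - subF xhat <= (e ^+ 2)%:E)%E /\ (subG y <= (e ^+ 2)%:E)%E.

End Subproblem.

(* A xt e delta omega is the output of the randomized algorithm at the outcome
   omega. The success event is not assumed measurable: it has to contain a
   measurable event of probability at least 1 - delta. *)
Definition is_oracle (dO : measure_display) (Omega : measurableType dO)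
    (P : probability Omega R) (rhohat : R)
    (A : 'rV[R]_d -> R -> R -> Omega -> 'rV[R]_d) : Prop :=
  forall xt e delta, X xt -> sub_feasible rhohat xt ->
    0 < e -> 0 < delta < 1 ->
    (forall w, X (A xt e delta w)) /\
    exists E : set Omega, [/\ measurable E,
      E `<=` [set w | good_output rhohat xt e (A xt e delta w)] &
      ((1 - delta)%:E <= P E)%E].

Section SwitchingSubgradient.
Variables rho rhohat M D : R.

Definition ssm_K (e : R) : nat :=
  `|Num.ceil (4 * (M ^+ 2 + rhohat ^+ 2 * D ^+ 2)
              / ((rhohat - rho) * e ^+ 2))|%N.

Definition ssm_step (k : nat) : R := 2 / ((rhohat - rho) * k.+2%:R).

Definition ssm_I (xt : 'rV[R]_d) (e : R) (z : nat -> 'rV[R]_d) : pred nat :=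
  fun k => (subG rhohat xt (z k) <= (e ^+ 2)%:E)%E.

(* Any subgradient may be taken at each iteration. The bound M + rhohat * D is
   imposed on the subgradients of G because the bound M on the subgradients of
   the f_i does not control every Frechet subgradient of their maximum at a
   boundary point of X; those coming from an active f_i always satisfy it.
   For F the bound follows from the one on the subgradients of f_0. *)
Definition ssm_run (xt : 'rV[R]_d) (e : R) (z : nat -> 'rV[R]_d) : Prop :=
  z 0 = xt /\
  forall k, (k < ssm_K e)%N ->
    exists2 zeta,
      (if ssm_I xt e z k then subdiff (subF rhohat xt) (z k) zeta
       else subdiff (subG rhohat xt) (z k) zeta /\
            enorm zeta <= M + rhohat * D) &
      z k.+1 = proj X (z k - ssm_step k *: zeta).

Definition ssm_out (xt : 'rV[R]_d) (e : R) (z : nat -> 'rV[R]_d) : 'rV[R]_d :=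
  (\sum_(k < ssm_K e | ssm_I xt e z k) k.+1%:R : R)^-1 *:
  \sum_(k < ssm_K e | ssm_I xt e z k) k.+1%:R *: z k.

Definition ssm_output (xt : 'rV[R]_d) (e : R) y : Prop :=
  exists2 z, ssm_run xt e z & y = ssm_out xt e z.

End SwitchingSubgradient.

End Problem.

Section IQRC.
Context {R : realType}.
Variables rho rhohat M D sigma : R.

Definition epshat (eps : R) : R :=
  Num.min 1
    (Num.sqrt ((rhohat - rho) / 4) *
     (Num.sqrt ((M + rhohat * D) / Num.sqrt (2 * sigma * (rhohat - rho)) + 1))^-1)
  * eps.

(* Delta stands for f(x_0) - f_lb. *)
Definition iqrc_T (Delta eps : R) : nat :=
  maxn 1 `|Num.ceil (4 * Delta / (eps ^+ 2 * (rhohat - rho)))|%N.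

Definition iqrc_complexity (Delta eps : R) : nat :=
  (iqrc_T Delta eps * ssm_K rho rhohat M D (epshat eps))%N.

(* The switching subgradient method is deterministic up to the choice of the
   subgradients and ignores the failure probability delta / T. *)
Definition iqrc_ssm_run (d m : nat) (X : set 'rV[R]_d)
    (f : 'I_m.+1 -> 'rV[R]_d -> \bar R) (x0 : 'rV[R]_d) (T : nat) (eps : R)
    (x : nat -> 'rV[R]_d) : Prop :=
  x 0 = x0 /\
  forall t, (t < T)%N ->
    ssm_output X f rho rhohat M D (x t) (epshat eps) (x t.+1).

End IQRC.

(* Expectation of phi at an index uniformly distributed on {0, ..., T - 1}. *)
Definition expect_unif (R : realType) (T : nat) (phi : nat -> R) : R :=
  (\sum_(t < T) phi t) / T%:R.

(* Main.v *)
Require Import Defs.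
From mathcomp Require Import ring lra.

(* Subgradient inequalities make every f_i + rho/2 |.|^2 convex on X, so F and G
   are strongly convex there with modulus mu = rhohat - rho, even though the
   subgradients of the maximum are only Frechet ones.  With step 2/(mu (k+2)) and
   weight k+1 the one-step inequalities telescope and the weighted sum of
   F(z_k) - F(xhat) (k in I) and G(z_k) - G(xhat) (k not in I) is at most
   K (M + rhohat D)^2 / mu < ehat^2 K(K+1)/2.  Steps outside I contribute more
   than ehat^2 each, so I is nonempty and Jensen's inequality gives (i).

   For (ii), let lambda be a multiplier of the subproblem at x_t.  Strong convexity
   of F + lambda G at its minimizer xhat_t gives
     mu/2 |x_t - xhat_t|^2 <= f(x_t) - f(x_{t+1}) + lambda max(g(x_t), 0) + ehat^2,
   which is summed over t.  The Slater point bounds lambda uniformly.  For t > 0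
   one has g(x_t) <= ehat^2, but x_0 is only eps^2-feasible: its extra error
   lambda eps^2 is absorbed by the strict gap between the bound on lambda and the
   constant in ehat, summed over the T ~ 1/eps^2 iterations. *)

Set Implicit Arguments.
Unset Strict Implicit.
Unset Printing Implicit Defensive.

Local Open Scope classical_set_scope.
Local Open Scope ring_scope.

(** * The Euclidean norm *)

Section EuclideanSpace.
Context {R : realType} {d : nat}.
Implicit Types (x y z u v w : 'rV[R]_d) (a b c t : R).

Lemma dotC u v : dot u v = dot v u.
Proof. by apply: eq_bigr => i _; rewrite mulrC. Qed.

Lemma dotDl u v w : dot (u + v) w = dot u w + dot v w.
Proof. by rewrite -big_split; apply: eq_bigr => i _; rewrite mxE mulrDl. Qed.

Lemma dotZl a u w : dot (a *: u) w = a * dot u w.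
Proof. by rewrite /dot mulr_sumr; apply: eq_bigr => i _; rewrite mxE mulrA. Qed.

Lemma dotNl u w : dot (- u) w = - dot u w.
Proof. by rewrite -scaleN1r dotZl mulN1r. Qed.

Lemma dotDr u v w : dot w (u + v) = dot w u + dot w v.
Proof. by rewrite !(dotC w) dotDl. Qed.

Lemma dotZr a u w : dot w (a *: u) = a * dot w u.
Proof. by rewrite !(dotC w) dotZl. Qed.

Lemma dotNr u w : dot w (- u) = - dot w u.
Proof. by rewrite !(dotC w) dotNl. Qed.

Definition dotE := (dotDl, dotDr, dotNl, dotNr, dotZl, dotZr).

Lemma dot_ge0 u : 0 <= dot u u.
Proof. by apply: sumr_ge0 => i _; rewrite -expr2 sqr_ge0. Qed.

Lemma dot_eq0 u : dot u u = 0 -> u = 0.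
Proof.
move=> /eqP; rewrite psumr_eq0; last by move=> i _; rewrite -expr2 sqr_ge0.
move=> /allP u0; apply/rowP => i; rewrite mxE.
by have /implyP/(_ isT) := u0 i (mem_index_enum _); rewrite mulf_eq0 orbb => /eqP.
Qed.

Lemma sqr_enorm u : enorm u ^+ 2 = dot u u.
Proof. by rewrite sqr_sqrtr// dot_ge0. Qed.

Lemma enorm_ge0 u : 0 <= enorm u.
Proof. exact: sqrtr_ge0. Qed.

Lemma enorm0 : enorm (0 : 'rV[R]_d) = 0.
Proof. by rewrite /enorm -(scale0r 0) dotZl mul0r sqrtr0. Qed.

Lemma enormN u : enorm (- u) = enorm u.
Proof. by rewrite /enorm !dotE opprK. Qed.

Lemma enormB u v : enorm (u - v) = enorm (v - u).
Proof. by rewrite -enormN opprB. Qed.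

Lemma enormZ a u : enorm (a *: u) = `|a| * enorm u.
Proof.
by rewrite /enorm !dotE mulrA -expr2 sqrtrM ?sqr_ge0// sqrtr_sqr.
Qed.

(** Cauchy-Schwarz: expand the squared norm of (u.u) v - (u.v) u and divide by u.u. *)
Lemma ler_dot u v : dot u v <= enorm u * enorm v.
Proof.
have [u0|] := eqVneq (dot u u) 0.
  by rewrite (dot_eq0 u0) -(scale0r 0) dotZl mul0r mulr_ge0// enorm_ge0.
move=> un0; have ugt0 : 0 < dot u u by rewrite lt_neqAle eq_sym un0 dot_ge0.
have := dot_ge0 (dot u u *: v - dot u v *: u).
rewrite !dotE (dotC v u) => h.
have {}h : 0 <= dot u u * (dot u u * dot v v - dot u v ^+ 2) by lra.
rewrite pmulr_rge0// -!sqr_enorm -exprMn subr_ge0 in h.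
have h0 : 0 <= enorm u * enorm v by rewrite mulr_ge0 ?enorm_ge0.
by rewrite (le_trans (ler_norm _))// -ler_sqr ?nnegrE ?normr_ge0// real_normK ?num_real.
Qed.

Lemma ler_enormD u v : enorm (u + v) <= enorm u + enorm v.
Proof.
have h : 0 <= enorm u + enorm v by rewrite addr_ge0 ?enorm_ge0.
rewrite -ler_sqr ?nnegrE ?enorm_ge0//.
have := ler_dot u v.
rewrite sqr_enorm !dotE -!sqr_enorm (dotC v u); lra.
Qed.

Lemma dot_continuous u : continuous (dot u).
Proof.
apply: (continuous_big (U := R^o)) => [|i _ x]; first exact: add_continuous.
apply: (@continuousM R _ (cst (u 0 i)) (fun v : 'rV[R]_d => v 0 i)).
  exact: cst_continuous.
exact: coord_continuous.
Qed.

Lemma dot_self_continuous : continuous (fun u => dot u u).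
Proof.
apply: (continuous_big (U := R^o)) => [|i _ x]; first exact: add_continuous.
by apply: (@continuousM R _ (fun v : 'rV[R]_d => v 0 i) (fun v => v 0 i));
  exact: coord_continuous.
Qed.

Lemma enorm_continuous : continuous (@enorm R d).
Proof.
move=> x; apply: continuous_comp; first exact: dot_self_continuous.
exact: sqrt_continuous.
Qed.

Lemma cvg_enormB x : enorm (y - x) @[y --> x] --> (0 : R).
Proof.
have h : {for x, continuous (fun y : 'rV[R]_d => y - x)}.
  by apply: continuousB; [|exact: cst_continuous].
have := continuous_comp h (@enorm_continuous _).
by rewrite /prop_for /continuous_at /= subrr enorm0.
Qed.

End EuclideanSpace.

(** * Strongly convex functions on a convex set *)

Section StrongConvexity.
Context {R : realType} {d : nat}.
Implicit Types (x y z p zeta : 'rV[R]_d) (X : set 'rV[R]_d).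
Implicit Types (H F G : 'rV[R]_d -> R) (mu t c : R).

Lemma convex_setP X x y t : convex_set X -> X x -> X y -> 0 <= t <= 1 ->
  X (x + t *: (y - x)).
Proof.
move=> cX Xx Xy /andP[t0 t1].
have := cX y x (Itv01 t0 t1); rewrite !inE => /(_ Xy Xx).
suff -> : x + t *: (y - x) = t *: y + (1 - t) *: x by [].
by rewrite scalerBl scale1r scalerBr addrCA addrC -addrA (addrC x).
Qed.

Lemma sumr_has_gt0 (I : Type) (r : seq I) (P : pred I) (a : I -> R) :
  (forall i, P i -> 0 < a i) -> has P r -> 0 < \sum_(i <- r | P i) a i.
Proof.
move=> a0; elim: r => // i r ih /=; rewrite big_cons; case: ifPn => [Pi _|//].
by rewrite ltr_pwDl ?a0// sumr_ge0// => k /a0/ltW.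
Qed.

(** By induction: adding a point gives a mean on the segment from that point to the old mean, at
    parameter S / (a i + S). *)
Lemma weighted_mean_mem X (I : Type) (r : seq I) (P : pred I) (a : I -> R)
    (z : I -> 'rV[R]_d) : convex_set X ->
  (forall i, P i -> 0 < a i) -> (forall i, P i -> X (z i)) -> has P r ->
  X ((\sum_(i <- r | P i) a i)^-1 *: \sum_(i <- r | P i) a i *: z i).
Proof.
move=> cX a0 Xz; elim: r => [//|i r ih]; rewrite !big_cons/=.
case: ifPn => [Pi _|_ /= /ih//].
have ai := a0 _ Pi.
have [hr|hr] := boolP (has P r); last first.
  rewrite !big_hasC// !addr0 scalerA mulVf ?gt_eqF// scale1r; exact: Xz.
have {ih} := ih hr; set S := \sum_(_ <- _ | _) a _; set V := \sum_(_ <- _ | _) _.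
move=> XV; have S0 : 0 < S.
  exact: sumr_has_gt0.
have D0 : 0 < a i + S by exact: addr_gt0.
have -> : (a i + S)^-1 *: (a i *: z i + V) =
    z i + S / (a i + S) *: (S^-1 *: V - z i).
  rewrite scalerDr scalerBr !scalerA.
  have -> : (a i + S)^-1 * a i = 1 - S / (a i + S) by field; exact: lt0r_neq0.
  have -> : S / (a i + S) / S = (a i + S)^-1 by field; rewrite !lt0r_neq0.
  by rewrite scalerBl scale1r -addrA (addrC (- _)).
apply: convex_setP => //; first exact: Xz.
by rewrite divr_ge0 ?(ltW S0) ?(ltW D0)// ler_pdivrMr// mul1r lerDr ltW.
Qed.

(** A negative [mu] is allowed: weak convexity of the [f i] is the case [mu = - rho]. *)
Definition supports mu X H y zeta :=
  forall x, X x -> H y + dot zeta (x - y) + mu / 2 * enorm (x - y) ^+ 2 <= H x.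

(** The first-order form is chosen because the assumptions supply subgradients, and an active [f i]
    passes its own on to the maximum. *)
Definition strongly_convex mu X H :=
  forall y, X y -> exists zeta, supports mu X H y zeta.

(** Evaluate the support at the intermediate point at both ends and average with weights 1 - t and
    t; the linear terms cancel. *)
Lemma strongly_convex_conv mu X H x y t : convex_set X ->
  strongly_convex mu X H -> X x -> X y -> 0 <= t <= 1 ->
  H (x + t *: (y - x)) <=
    (1 - t) * H x + t * H y - mu / 2 * t * (1 - t) * enorm (y - x) ^+ 2.
Proof.
move=> cX scH Xx Xy t01; have Xw := convex_setP cX Xx Xy t01.
have [zeta sH] := scH _ Xw; set w := x + _ in Xw sH *.
have := sH _ Xx; have := sH _ Xy.
have -> : x - w = - t *: (y - x) by rewrite /w opprD addNKr scaleNr.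
have -> : y - w = (1 - t) *: (y - x).
  by rewrite /w opprD addrA scalerBl scale1r.
rewrite !sqr_enorm !dotZl !dotZr.
set q := dot (y - x) _; set l := dot zeta _.
case/andP: t01 => t0 t1 h1 h2.
have := lerD (ler_wpM2l t0 h1) (ler_wpM2l (_ : 0 <= 1 - t) h2).
by rewrite subr_ge0 => /(_ t1); lra.
Qed.

(** Jensen's inequality: sum the support at the mean over all points; the weighted deviations from
    the mean add up to zero. *)
Lemma strongly_convex_mean mu X H (I : Type) (r : seq I) (P : pred I)
    (a : I -> R) (z : I -> 'rV[R]_d) : 0 <= mu -> convex_set X ->
  strongly_convex mu X H ->
  (forall i, P i -> 0 < a i) -> (forall i, P i -> X (z i)) -> has P r ->
  (\sum_(i <- r | P i) a i) *
    H ((\sum_(i <- r | P i) a i)^-1 *: \sum_(i <- r | P i) a i *: z i) <=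
  \sum_(i <- r | P i) a i * H (z i).
Proof.
move=> mu0 cX scH a0 Xz hr.
have := weighted_mean_mem cX a0 Xz hr; set S := \sum_(_ <- _ | _) a _.
set y := _ *: _ => Xy; have [zeta sy] := scH _ Xy.
have S0 : S != 0 by rewrite gt_eqF// sumr_has_gt0.
have yE : \sum_(i <- r | P i) a i *: (z i - y) = 0.
  under eq_bigr do rewrite scalerBr.
  by rewrite sumrB -scaler_suml -/S /y scalerA divff// scale1r subrr.
have -> : S * H y = \sum_(i <- r | P i) (a i * H y + dot zeta (a i *: (z i - y))).
  rewrite big_split/= -mulr_suml -/S.
  rewrite -[X in _ = _ + X](_ : dot zeta (\sum_(i <- r | P i) a i *: (z i - y)) = _).
    by rewrite yE -(scale0r 0) dotZr mul0r addr0.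
  apply: (big_morph (dot zeta)) => [u v|]; first by rewrite dotDr.
  by rewrite -(scale0r 0) dotZr mul0r.
apply: ler_sum => i Pi; rewrite dotZr -mulrDr ler_pM2l ?a0//.
apply: le_trans (sy _ (Xz _ Pi)); rewrite lerDl.
by rewrite mulr_ge0 ?sqr_ge0// divr_ge0.
Qed.

(** Replaces the passage to the limit t -> 0 after a division by t. *)
Lemma lerZ_gap a b : (forall t, 0 < t <= 1 -> a <= b * t) -> a <= 0 :> R.
Proof.
move=> h; apply/ler_addgt0Pr => e e0; rewrite add0r.
have b0 : 0 < `|b| + 1 by rewrite ltr_wpDl.
pose t := Num.min 1 (e / (`|b| + 1)).
have t0 : 0 < t by rewrite lt_min ltr01 divr_gt0.
rewrite (le_trans (h t _))//; first by rewrite t0 ge_min lexx.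
rewrite (le_trans (ler_wpM2r (ltW t0) (ler_norm b)))//.
have : t * (`|b| + 1) <= e by rewrite -ler_pdivlMr// ge_min lexx orbT.
lra.
Qed.

(** Compare [H p] with the values on the segment from p to y, divide by t and let t tend to 0. *)
Lemma strongly_convex_min mu X H p y : convex_set X ->
  strongly_convex mu X H -> X p -> (forall x, X x -> H p <= H x) -> X y ->
  H p + mu / 2 * enorm (y - p) ^+ 2 <= H y.
Proof.
move=> cX scH Xp minp Xy; rewrite -subr_le0.
apply: (@lerZ_gap _ (mu / 2 * enorm (y - p) ^+ 2)) => t /andP[t0 t1].
have t01 : 0 <= t <= 1 by rewrite (ltW t0).
have := strongly_convex_conv cX scH Xp Xy t01.
have := minp _ (convex_setP cX Xp Xy t01).
move=> h1 h2; have := le_trans h1 h2; set q := mu / 2 * _ => h.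
rewrite -(ler_pM2l t0); move: h; rewrite /q; lra.
Qed.

(** The sublevel set is the part of [X] cut out by the half-spaces of all supports, so no continuity
    of [H] is used. *)
Lemma closed_sublevel mu X H c : 0 <= mu -> closed X ->
  strongly_convex mu X H -> closed [set y | X y /\ H y <= c].
Proof.
move=> mu0 cX scH.
have -> : [set y | X y /\ H y <= c] = X `&`
    \bigcap_(p in [set p | X p.1 /\ supports mu X H p.1 p.2])
      (fun y => dot p.2 y) @^-1` [set r | r <= c - H p.1 + dot p.2 p.1].
  apply/seteqP; split=> y [Xy Hy]; split=> //=.
    move=> [z zeta]/= [Xz /(_ _ Xy)].
    have : 0 <= mu / 2 * enorm (y - z) ^+ 2 by rewrite mulr_ge0 ?sqr_ge0// divr_ge0.
    by rewrite !dotE; lra.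
  have [zeta sy] := scH _ Xy.
  by have /= := Hy (y, zeta) (conj Xy sy); lra.
apply: closedI => //; apply: closed_bigI => -[z zeta] /= _.
apply: preimage_closed; last exact: closed_le.
by move=> x _; exact: dot_continuous.
Qed.

Lemma seq_argmin (T : eqType) (h : T -> R) (s : seq T) (x0 : T) : x0 \in s ->
  exists2 x, x \in s & forall y : T, y \in s -> h x <= h y.
Proof.
elim: s x0 => [//|a [|b s] ih x0 _].
  by exists a => [|y]; rewrite ?mem_head// inE => /eqP->.
have [x xs minx] := ih b (mem_head _ _).
have [ax|xa] := leP (h a) (h x).
  exists a => [|y]; rewrite ?mem_head// in_cons => /predU1P[->//|/minx].
  exact: le_trans.
exists x => [|y]; first by rewrite in_cons xs orbT.
by rewrite in_cons => /predU1P[->|/minx//]; exact: ltW.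
Qed.

Lemma strongly_convex_argmin mu X C H : 0 <= mu -> closed X ->
  strongly_convex mu X H -> C `<=` X -> compact C -> C !=set0 ->
  exists2 p, C p & forall y, C y -> H p <= H y.
Proof.
move=> mu0 cX scH CX cC [c0 Cc0].
pose S z := C `&` [set y | X y /\ H y <= H z].
(* A point below every value taken on [C] exists by the finite intersection property: a finite
   subfamily is met at the point where [H] is least among its indices. *)
have : \bigcap_(z in C) S z !=set0.
  have := cC; rewrite compact_In0; apply.
    exists (fun z => [set y | X y /\ H y <= H z]) => // z _.
    exact: closed_sublevel scH.
  move=> D' D'C.
  have [->|[z0 z0D]] := finmap.fset_0Vmem D'.
    by exists c0 => i; rewrite /= inE.
  have [z zD zmin] := seq_argmin H (z0D : z0 \in finmap.enum_fset D').
  have Cz : C z by have := D'C _ zD; rewrite inE.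
  exists z => y /= yD; split => //; split; first exact: CX.
  exact: zmin.
case=> p pS; exists p; first by have [] := pS _ Cc0.
by move=> y /pS[_ []].
Qed.

End StrongConvexity.

(** * Frechet subgradients, Lagrange multipliers and projections *)

Section StrongConvexityConsequences.
Context {R : realType} {d : nat}.
Implicit Types (x y z p zeta : 'rV[R]_d) (X : set 'rV[R]_d).
Implicit Types (H F G : 'rV[R]_d -> R) (L mu t c : R).

(** A Frechet subgradient is only a local condition. Applied at z + t (x - z) and combined with
    convexity on the segment, it becomes global after division by t, the little-o error being at
    most [e * t * n]. This covers subgradients of the maximum that come from no active [f i]. *)
Lemma subdiff_supports mu X (h : 'rV[R]_d -> \bar R) H z zeta :
  0 <= mu -> convex_set X -> strongly_convex mu X H ->
  (forall x, X x -> h x = (H x)%:E) -> X z -> subdiff h z zeta ->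
  supports mu X H z zeta.
Proof.
move=> mu0 cX scH hE Xz [_ [r /eqoP ro hr]] x Xx; rewrite -subr_le0.
set v := x - z; set n := enorm v.
have n0 : 0 <= n by exact: enorm_ge0.
apply: (@lerZ_gap _ _ (n + mu / 2 * n ^+ 2)) => e /andP[e0 e1].
have [s /= s0 sP] := (nbhs_ballP z _).1 (filterI (ro e e0) hr).
have v0 : 0 < `|v| + 1 by rewrite ltr_wpDl.
pose t := Num.min e (s / (`|v| + 1)).
have t0 : 0 < t by rewrite lt_min e0 divr_gt0.
have te : t <= e by rewrite ge_min lexx.
have t01 : 0 <= t <= 1 by rewrite ltW//= (le_trans te).
have Xw := convex_setP cX Xz Xx t01.
have /sP[/=] : ball z s (z + t *: v).
  rewrite -ball_normE/= opprD addNKr normrN normrZ gtr0_norm//.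
  have : t * (`|v| + 1) <= s by rewrite -ler_pdivlMr// ge_min lexx orbT.
  by lra.
rewrite !hE// addrAC subrr add0r -EFinD lee_fin enormZ (gtr0_norm t0) -/n.
rewrite (ger0_norm (mulr_ge0 (ltW t0) n0)) ler_norml dotZr => /andP[h1 _] h2.
have h3 := strongly_convex_conv cX scH Xz Xx t01; rewrite -/v -/n in h3.
rewrite -(ler_pM2l t0).
have h4 : mu / 2 * n ^+ 2 * t <= mu / 2 * n ^+ 2 * e.
  by rewrite ler_wpM2l// mulr_ge0 ?sqr_ge0// divr_ge0.
have h5 := ler_wpM2l (ltW t0) h4.
by lra.
Qed.

(** The growth of the modulus with c is what later sharpens the bound on the multiplier. *)
Lemma strongly_convexD mu X F G c : 0 <= c ->
  strongly_convex mu X F -> strongly_convex mu X G ->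
  strongly_convex ((1 + c) * mu) X (fun x => F x + c * G x).
Proof.
move=> c0 scF scG y Xy; have [a ha] := scF _ Xy; have [b hb] := scG _ Xy.
exists (a + c *: b) => x Xx; have := ha _ Xx; have := ler_wpM2l c0 (hb _ Xx).
by rewrite dotDl dotZl; lra.
Qed.

(** The multiplier is the infimum of (F y - F p) / (- G y) over strictly feasible y. An infeasible y
    yields a lower bound of these quotients, because the segment from a strictly feasible x to y
    contains a feasible point at which p is still optimal. *)
Lemma lagrange_multiplier mu X F G p s : 0 <= mu -> convex_set X ->
  strongly_convex mu X F -> strongly_convex mu X G ->
  X p -> G p <= 0 -> (forall y, X y -> G y <= 0 -> F p <= F y) ->
  X s -> G s < 0 ->
  exists2 c, 0 <= c & forall y, X y -> F p <= F y + c * G y.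
Proof.
move=> mu0 cX scF scG Xp Gp minp Xs Gs.
pose B := [set (F y - F p) / - G y | y in [set y | X y /\ G y < 0]].
have B0 : lbound B 0.
  move=> _ [y [Xy Gy] <-]; rewrite divr_ge0 ?oppr_ge0 ?(ltW Gy)//.
  by rewrite subr_ge0 minp// ltW.
have Bne : B !=set0 by exists ((F s - F p) / - G s), s.
exists (inf B) => [|y Xy]; first exact: lb_le_inf.
have [Gy|Gy|Gy] := ltgtP (G y) 0; last by rewrite Gy mulr0 addr0 minp// Gy.
  have : inf B <= (F y - F p) / - G y by apply: ge_inf; [exists 0|exists y].
  by rewrite ler_pdivlMr ?oppr_gt0//; lra.
suff : (F p - F y) / G y <= inf B by rewrite ler_pdivrMr//; lra.
apply: lb_le_inf => // _ [x [Xx Gx] <-].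
have D0 : 0 < G y - G x by lra.
have D1 : G y - G x != 0 by rewrite gt_eqF.
(* The linear interpolation of [G] between x and y vanishes at this t. *)
pose t := - G x / (G y - G x).
have t01 : 0 <= t <= 1.
  by rewrite divr_ge0 ?oppr_ge0 ?(ltW Gx) ?(ltW D0)//= ler_pdivrMr// mul1r; lra.
have tE : t * (G y - G x) = - G x by rewrite mulfVK.
have q0 : 0 <= mu / 2 * t * (1 - t) * enorm (y - x) ^+ 2.
  case/andP: t01 => t0 t1.
  by rewrite mulr_ge0 ?sqr_ge0// mulr_ge0 ?subr_ge0// mulr_ge0// divr_ge0.
have hG := strongly_convex_conv cX scG Xx Xy t01.
have hF := strongly_convex_conv cX scF Xx Xy t01.
have {}hG : G (x + t *: (y - x)) <= 0 by lra.
have hp := minp _ (convex_setP cX Xx Xy t01) hG.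
have {hp}hF : 0 <= (F x - F p) + t * (F y - F x) by lra.
have {hF}hF := mulr_ge0 (ltW D0) hF.
have tE' : (G y - G x) * (t * (F y - F x)) = - G x * (F y - F x).
  by rewrite mulrA (mulrC _ t) tE.
rewrite ler_pdivrMr// mulrAC ler_pdivlMr ?oppr_gt0//; lra.
Qed.

(** Completing the square in r: L r - (1 + c) mu r^2 / 2 is at most L^2 / (2 (1 + c) mu). *)
Lemma multiplier_bound L mu sigma c r : 0 < mu -> 0 < sigma -> 0 <= c ->
  c * sigma + (1 + c) * mu / 2 * r ^+ 2 <= L * r ->
  c * (1 + c) * (2 * sigma * mu) <= L ^+ 2.
Proof.
move=> mu0 s0 c0 h; have c1 : 0 <= 2 * mu * (1 + c) by rewrite !mulr_ge0// ?addr_ge0// ltW.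
by have := ler_wpM2l c1 h; have := sqr_ge0 (L - (1 + c) * mu * r); lra.
Qed.

Section Projection.
Variables (X : set 'rV[R]_d).
Hypotheses (cX : convex_set X) (kX : compact X) (X0 : X !=set0).

Lemma strongly_convex_sqdist x :
  strongly_convex 2 X (fun y => enorm (x - y) ^+ 2).
Proof.
move=> y _; exists (2 *: (y - x)) => z _.
by rewrite !sqr_enorm !dotE (dotC y x) (dotC z x) (dotC z y); lra.
Qed.

Lemma projP x :
  X (proj X x) /\ forall y, X y -> enorm (x - proj X x) <= enorm (x - y).
Proof.
apply: (@getPex _ [set p | X p /\ forall y, X y -> enorm (x - p) <= enorm (x - y)]).
have [p Xp minp] := strongly_convex_argmin (ler0n R 2)
  (compact_closed (@norm_hausdorff _ _) kX) (strongly_convex_sqdist x)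
  (@subset_refl _ X) kX X0.
exists p; split=> // y /minp; by rewrite ler_sqr// nnegrE enorm_ge0.
Qed.

(** Strong convexity of the squared distance at its minimizer gives |x - y|^2 >= |x - proj x|^2 + |y
    - proj x|^2. *)
Lemma proj_dist x y : X y -> enorm (proj X x - y) ^+ 2 <= enorm (x - y) ^+ 2.
Proof.
move=> Xy; have [Xp minp] := projP x.
have := strongly_convex_min cX (strongly_convex_sqdist x) Xp _ Xy.
have h z : X z -> enorm (x - proj X x) ^+ 2 <= enorm (x - z) ^+ 2.
  by move=> /minp; rewrite ler_sqr// nnegrE enorm_ge0.
rewrite (enormB (proj X x)) => /(_ h); have := sqr_ge0 (enorm (x - proj X x)); lra.
Qed.

(** The distance inequality is scaled by mu (k+1)(k+2) / 4. Strong convexity removes mu (k+1) / 2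
    from the coefficient of the old distance, leaving mu k (k+1) / 4, so consecutive steps
    telescope. The squared step costs (k+1)/(k+2) L^2/mu. *)
Lemma subgradient_step mu H L z zeta p k : 0 < mu -> supports mu X H z zeta ->
  enorm zeta <= L -> X p ->
  k.+1%:R * (H z - H p) + mu / 4 * (k.+1 * k.+2)%:R *
    enorm (proj X (z - (2 / (mu * k.+2%:R)) *: zeta) - p) ^+ 2 <=
  mu / 4 * (k * k.+1)%:R * enorm (z - p) ^+ 2 + L ^+ 2 / mu.
Proof.
move=> mu0 sz zL Xp; have := sz _ Xp; set g := 2 / _.
have := proj_dist (z - g *: zeta) Xp; set D' := enorm (proj _ _ - p) ^+ 2.
have zL2 : dot zeta zeta <= L ^+ 2.
  by rewrite -sqr_enorm ler_sqr// nnegrE ?enorm_ge0// (le_trans (enorm_ge0 zeta)).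
rewrite (enormB p z) -(opprB z p) dotNr (addrAC z) !(sqr_enorm (_ + _)).
move: (z - p) => v; rewrite !dotE (dotC v zeta).
set q := dot zeta zeta in zL2 *; set l := dot zeta v; set n := dot v v.
move=> h1 h2; have k2 : 0 < k.+2%:R :> R by rewrite ltr0n.
have a0 : 0 <= mu / 4 * k.+1%:R * k.+2%:R by rewrite !mulr_ge0// ltW.
have := ler_wpM2l a0 h1.
have kE : mu * k.+2%:R * g = 2 by rewrite /g mulrC mulfVK// gt_eqF// mulr_gt0.
have gL : mu / 4 * k.+1%:R * k.+2%:R * (g * (g * q)) <= L ^+ 2 / mu.
  have -> : mu / 4 * k.+1%:R * k.+2%:R * (g * (g * q)) =
      (k.+1%:R / k.+2%:R) * (q / mu).
    by rewrite /g; field; rewrite !gt_eqF.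
  have h : k.+1%:R / k.+2%:R <= 1 :> R by rewrite ler_pdivrMr// mul1r ler_nat.
  have q0 : 0 <= q / mu by rewrite divr_ge0 ?dot_ge0 ?ltW.
  apply: le_trans (ler_wpM2r q0 h) _.
  by rewrite mul1r ler_pM2r// invr_gt0.
have := ler_wpM2l (ler0n R k.+1) h2.
have gl : mu / 4 * k.+1%:R * k.+2%:R * (g * l) = k.+1%:R * l / 2.
  transitivity (mu * k.+2%:R * g * (k.+1%:R * l / 4)); first by ring.
  by rewrite kE; field.
rewrite !natrM -(natr1 k.+1) -(natr1 k) in gl gL *.
lra.
Qed.

End Projection.
End StrongConvexityConsequences.

(** * The switching subgradient method *)

Lemma sum_succ (R : realType) n :
  \sum_(k < n) k.+1%:R = (n * n.+1)%:R / 2 :> R.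
Proof.
elim: n => [|n ih]; first by rewrite big_ord0 mul0n mul0r.
by rewrite big_ord_recr/= ih !natrM -(natr1 n.+1) -(natr1 n); lra.
Qed.

Section Switching.
Context {R : realType} {d : nat}.
Variables (X : set 'rV[R]_d) (F G : 'rV[R]_d -> R) (mu L e : R).
Variables (p : 'rV[R]_d) (z : nat -> 'rV[R]_d) (K : nat).
Hypotheses (cX : convex_set X) (kX : compact X) (mu0 : 0 < mu).
Hypotheses (scF : strongly_convex mu X F) (scG : strongly_convex mu X G).
Hypotheses (Xp : X p) (Gp : G p <= 0) (Xz0 : X (z 0)).
Hypothesis z_step : forall k, (k < K)%N -> exists2 zeta,
  enorm zeta <= L /\ supports mu X (if G (z k) <= e then F else G) (z k) zeta &
  z k.+1 = proj X (z k - (2 / (mu * k.+2%:R)) *: zeta).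
Hypotheses (e0 : 0 < e) (K0 : (0 < K)%N) (KL : 2 * L ^+ 2 <= mu * e * K%:R).

Let X0 : X !=set0. Proof. by exists p. Qed.

Lemma switching_mem k : (k <= K)%N -> X (z k).
Proof.
case: k => [//|k] /z_step[zeta _ ->]; exact: (projP kX X0 _).1.
Qed.

Lemma switching_sum_le n : (n <= K)%N ->
  \sum_(k < n) k.+1%:R * (if G (z k) <= e then F (z k) - F p else G (z k) - G p) +
    mu / 4 * (n * n.+1)%:R * enorm (z n - p) ^+ 2 <= n%:R * (L ^+ 2 / mu).
Proof.
elim: n => [_|n ih nK]; first by rewrite big_ord0 mul0n mulr0 !mul0r addr0.
rewrite big_ord_recr/=; have [zeta [zL sz] zE] := z_step nK.
have := subgradient_step cX kX X0 n mu0 sz zL Xp; rewrite -zE.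
have := ih (ltnW nK); rewrite -(natr1 n).
by case: ifP => _; lra.
Qed.

(** Here [e] plays the role of the squared tolerance. The whole weighted sum is below e K (K+1) / 2,
    the sum of all e (k+1), and each step with [G (z k) > e] contributes at least its share because
    [G p <= 0]. Strictness, due to K < K + 1, forces some step to have [G (z k) <= e]. *)
Lemma switching_sum_lt0 :
  \sum_(k < K | G (z k) <= e) k.+1%:R * (F (z k) - F p - e) < 0.
Proof.
have KR : 0 < K%:R :> R by rewrite ltr0n.
have hK : K%:R * (L ^+ 2 / mu) < e * ((K * K.+1)%:R / 2).
  have : L ^+ 2 / mu <= e * K%:R / 2.
    by rewrite ler_pdivrMr//; have := KL; lra.
  move=> /(ler_wpM2l (ltW KR)) h; apply: le_lt_trans h _.
  rewrite natrM -(natr1 K); have := mulr_gt0 e0 KR; lra.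
have := switching_sum_le (leqnn K).
have q0 : 0 <= mu / 4 * (K * K.+1)%:R * enorm (z K - p) ^+ 2.
  by rewrite mulr_ge0 ?sqr_ge0// mulr_ge0// divr_ge0// ltW.
set S := \sum_(k < K) _ => h; have {q0 hK h} : S < e * ((K * K.+1)%:R / 2) by lra.
rewrite /S -sum_succ mulr_sumr -subr_lt0 -sumrB; apply: le_lt_trans.
rewrite [X in _ <= X](bigID (fun k : 'I_K => G (z k) <= e))/= -[X in X <= _]addr0.
apply: lerD.
  by apply: ler_sum => k ->; rewrite le_eqVlt; apply/orP; left; apply/eqP; ring.
apply: sumr_ge0 => k /negbTE Gk; rewrite Gk (mulrC e) -mulrBr mulr_ge0//.
move/negbT: Gk; rewrite -ltNge; have := Gp; lra.
Qed.

Let P : pred 'I_K := fun k => G (z k) <= e.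
Let y := (\sum_(k < K | P k) k.+1%:R : R)^-1 *: \sum_(k < K | P k) k.+1%:R *: z k.

Lemma switching_has : has P (index_enum 'I_K).
Proof.
apply: contraT => h; have := switching_sum_lt0.
by rewrite big_hasC// ltxx.
Qed.

Lemma switching_mean :
  [/\ exists2 k, (k < K)%N & G (z k) <= e, X y, F y - F p <= e & G y <= e].
Proof.
have hP := switching_has.
have k0 (k : 'I_K) : P k -> 0 < k.+1%:R :> R by rewrite ltr0n.
have Xz (k : 'I_K) : P k -> X (z k) by move=> _; apply: switching_mem; exact: ltnW.
have W0 := sumr_has_gt0 k0 hP.
have mean H c : strongly_convex mu X H ->
    \sum_(k < K | P k) k.+1%:R * (H (z k) - c) <= 0 -> H y <= c.
  move=> scH h; rewrite -(ler_pM2l W0).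
  apply: le_trans (strongly_convex_mean (ltW mu0) cX scH k0 Xz hP) _.
  rewrite mulr_suml -subr_le0 -sumrB; apply: le_trans h.
  by apply: ler_sum => k _; rewrite mulrBr.
split.
- by have /hasP[k _ Pk] := hP; exists k.
- exact: weighted_mean_mem.
- rewrite lerBlDr; apply: mean => //.
  apply: le_trans (ltW switching_sum_lt0); apply: ler_sum => k _.
  by rewrite opprD addrA addrAC.
- apply: mean => //; apply: sumr_le0 => k Pk.
  by rewrite mulr_ge0_le0// subr_le0.
Qed.

End Switching.

(** * The proximal subproblem *)

Section QuadraticPerturbation.
Context {R : realType} {d : nat}.
Implicit Types (x y z c zeta : 'rV[R]_d) (X : set 'rV[R]_d).

(** The exact Taylor expansion at y, whose last term shifts moduli by a. *)
Lemma quad_expand (a : R) c x y :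
  a / 2 * enorm (x - c) ^+ 2 = a / 2 * enorm (y - c) ^+ 2 +
    dot (a *: (y - c)) (x - y) + a / 2 * enorm (x - y) ^+ 2.
Proof.
rewrite !sqr_enorm -(subrKA y x (- c)).
move: (x - y) (y - c) => u v; rewrite !dotE (dotC v u); lra.
Qed.

Lemma supports_add_quad (b a : R) X (h : 'rV[R]_d -> R) c y zeta :
  supports b X h y zeta ->
  supports (a + b) X (fun x => h x + a / 2 * enorm (x - c) ^+ 2) y
    (zeta + a *: (y - c)).
Proof.
move=> sh x Xx; rewrite (quad_expand a c x y) dotDl.
have := sh _ Xx; lra.
Qed.

(** The second-order term of the quadratic is o(|x' - x|) and is moved into the remainder. This
    carries the bound M over to the subgradients of F. *)
Lemma subdiff_add_quad (a : R) c (h : 'rV[R]_d -> \bar R) x zeta :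
  subdiff (add_quad a c h) x zeta -> subdiff h x (zeta - a *: (x - c)).
Proof.
rewrite /subdiff/= /add_quad fin_numD/= andbT => -[hx [r ro hr]]; split=> //.
exists (fun x' => r x' - a / 2 * enorm (x' - x) ^+ 2).
  apply/eqoP => e e0; move/eqoP : ro => ro.
  have e2 : 0 < e / 2 by exact: divr_gt0.
  pose s := e / (`|a| + 1).
  have a0 : 0 < `|a| + 1 by rewrite ltr_wpDl.
  have s0 : 0 < s by exact: divr_gt0.
  have nx : \forall x' \near x, enorm (x' - x) < s.
    exact: (cvgr_lt 0 (cvg_enormB x) s s0).
  near=> x'.
  have h1 : `|r x'| <= e / 2 * `|enorm (x' - x)| by near: x'; exact: ro.
  have h2 : enorm (x' - x) < s by near: x'.
  have n0 := enorm_ge0 (x' - x).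
  move: h1; rewrite (ger0_norm n0) => h1.
  rewrite (le_trans (ler_normB _ _))// 2!normrM normfV normr_nat.
  rewrite (ger0_norm (sqr_ge0 _)).
  have h3 : `|a| * enorm (x' - x) <= e.
    have : (`|a| + 1) * enorm (x' - x) <= e by rewrite mulrC -ler_pdivlMr// ltW.
    lra.
  by have := ler_wpM2r n0 h3; lra.
apply: filterS hr => x'.
rewrite (quad_expand a c x' x) -(fineK hx) -!EFinD.
case: (h x') => [hx'||]//=; last by move=> _; rewrite leey.
by rewrite -EFinD !lee_fin dotDl dotNl; lra.
Unshelve. all: by end_near. Qed.

End QuadraticPerturbation.

(** [fine] sends infinite values to 0, but under the assumptions all values on [X] are finite. *)
Definition realF {R : realType} {d m : nat} (f : 'I_m.+1 -> 'rV[R]_d -> \bar R)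
  rhohat xt y := fine (subF f rhohat xt y).
Definition realG {R : realType} {d m : nat} (f : 'I_m.+1 -> 'rV[R]_d -> \bar R)
  rhohat xt y := fine (subG f rhohat xt y).

Section Subproblem.
Context {R : realType} {d m : nat}.
Variables (X : set 'rV[R]_d) (f : 'I_m.+1 -> 'rV[R]_d -> \bar R).
Variables (eps rho rhoeps sigma M D flb : R) (xfeas : 'rV[R]_d).
Hypothesis A : assumptions X f eps rho rhoeps sigma M D flb xfeas.
Implicit Types x y z : 'rV[R]_d.

Lemma f_fin_num i x : X x -> f i x \is a fin_num.
Proof. by move=> /(f_subdiff_neq0 A i)[zeta []]. Qed.

Lemma constr_active x : exists i, constr f x = f (lift ord0 i) x.
Proof.
rewrite /constr; have [|i _ ->] := @eq_bigmax _ _ _ (-oo)%E (Ordinal (ncons_gt0 A)) xpredT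
  (fun i => f (lift ord0 i) x) isT; last by exists i.
by move=> i _; exact: leNye.
Qed.

Lemma le_constr i x : (f (lift ord0 i) x <= constr f x)%E.
Proof. exact: (le_bigmax _ (fun i => f (lift ord0 i) x)). Qed.

Lemma constr_fin_num x : X x -> constr f x \is a fin_num.
Proof. by move=> Xx; have [i ->] := constr_active x; exact: f_fin_num. Qed.

Lemma f_supports i x zeta : X x -> subdiff (f i) x zeta ->
  supports (- rho) X (fun y => fine (f i y)) x zeta.
Proof.
move=> Xx hz y Xy; have := f_weakly_convex A Xy Xx hz.
rewrite -(fineK (f_fin_num i Xy)) -(fineK (f_fin_num i Xx)) lee_fin /=.
lra.
Qed.

(** A subgradient of an active [f i] works: the maximum dominates [f i] and agrees with it at x. *)
Lemma constr_supports x : X x ->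
  exists zeta, supports (- rho) X (fun y => fine (constr f y)) x zeta.
Proof.
move=> Xx; have [i ci] := constr_active x.
have [zeta hz] := f_subdiff_neq0 A (lift ord0 i) Xx.
exists zeta => y Xy; rewrite ci; apply: le_trans (f_supports Xx hz Xy) _.
by rewrite fine_le ?f_fin_num ?constr_fin_num// le_constr.
Qed.

Variables (rhohat : R) (xt : 'rV[R]_d).
Hypotheses (hrho : rho < rhohat) (Xxt : X xt).

Local Notation F := (realF f rhohat xt).
Local Notation G := (realG f rhohat xt).

Lemma F_fine y : X y -> F y = fine (obj f y) + rhohat / 2 * enorm (y - xt) ^+ 2.
Proof. by move=> Xy; rewrite /realF /subF /add_quad fineD// f_fin_num. Qed.

Lemma G_fine y : X y -> G y = fine (constr f y) + rhohat / 2 * enorm (y - xt) ^+ 2.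
Proof. by move=> Xy; rewrite /realG /subG /add_quad fineD// constr_fin_num. Qed.

Lemma subFE y : X y -> subF f rhohat xt y = (F y)%:E.
Proof. by move=> Xy; rewrite fineK// fin_numD f_fin_num. Qed.

Lemma subGE y : X y -> subG f rhohat xt y = (G y)%:E.
Proof. by move=> Xy; rewrite fineK// fin_numD constr_fin_num. Qed.

Lemma sub_subgrad_bound x zeta : X x -> subdiff (obj f) x zeta ->
  enorm (zeta + rhohat *: (x - xt)) <= M + rhohat * D.
Proof.
move=> Xx hz; apply: le_trans (ler_enormD _ _) _; apply: lerD.
  exact: (subgrad_bound A) hz.
have r0 : 0 <= rhohat by rewrite ltW// (le_lt_trans (rho_ge0 A)).
by rewrite enormZ ger0_norm// ler_wpM2l// (X_diam A).
Qed.

Lemma subF_supports y : X y ->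
  exists2 zeta, enorm zeta <= M + rhohat * D & supports (rhohat - rho) X F y zeta.
Proof.
move=> Xy; have [zeta hz] := f_subdiff_neq0 A ord0 Xy.
exists (zeta + rhohat *: (y - xt)); first exact: sub_subgrad_bound.
move=> x Xx; rewrite !F_fine//.
exact: (supports_add_quad rhohat xt (f_supports Xy hz)).
Qed.

Lemma subF_strongly_convex : strongly_convex (rhohat - rho) X F.
Proof. by move=> y /subF_supports[zeta _ sz]; exists zeta. Qed.

Lemma subG_strongly_convex : strongly_convex (rhohat - rho) X G.
Proof.
move=> y Xy; have [zeta hz] := constr_supports Xy.
exists (zeta + rhohat *: (y - xt)) => x Xx; rewrite !G_fine//.
exact: (supports_add_quad rhohat xt hz).
Qed.

Lemma subF_lipschitz x y : X x -> X y ->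
  F y - F x <= (M + rhohat * D) * enorm (y - x).
Proof.
move=> Xx Xy; have [zeta zL sz] := subF_supports Xy.
have := sz _ Xx; rewrite -(opprB y x) dotNr.
have := ler_dot zeta (y - x).
have := ler_wpM2r (enorm_ge0 (y - x)) zL.
have : 0 <= (rhohat - rho) / 2 * enorm (- (y - x)) ^+ 2.
  by rewrite mulr_ge0 ?sqr_ge0// divr_ge0// subr_ge0 ltW.
lra.
Qed.

Lemma sub_feasibleP : sub_feasible X f rhohat xt <-> exists2 y, X y & G y <= 0.
Proof.
by split=> -[y Xy]; [rewrite subGE// lee_fin|move=> Gy]; exists y => //; rewrite subGE.
Qed.

(** [xhat] is a choice, so a minimizer has to be exhibited; the feasible set is a closed sublevel
    set in a compact set. *)
Lemma xhatP (p := xhat X f rhohat xt) : sub_feasible X f rhohat xt ->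
  [/\ X p, G p <= 0 & forall y, X y -> G y <= 0 -> F p <= F y].
Proof.
move=> /sub_feasibleP[y0 Xy0 Gy0].
have mu0 : 0 <= rhohat - rho by rewrite subr_ge0 ltW.
have kX := X_compact A; have clX := compact_closed (@norm_hausdorff _ _) kX.
pose C := [set y | X y /\ G y <= 0].
have CX : C `<=` X by move=> y [].
have kC : compact C.
  by apply: (subclosed_compact _ kX CX); exact: closed_sublevel subG_strongly_convex.
have [q [Xq Gq] minq] := strongly_convex_argmin mu0 clX subF_strongly_convex CX kC
  (ex_intro _ y0 (conj Xy0 Gy0)).
have : [set y | [/\ X y, (subG f rhohat xt y <= 0)%E & forall y', X y' ->
    (subG f rhohat xt y' <= 0)%E -> (subF f rhohat xt y <= subF f rhohat xt y')%E]] p.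
  apply: getPex; exists q; split=> //; first by rewrite subGE.
  by move=> y' Xy'; rewrite subGE// !subFE// !lee_fin => Gy'; exact: minq.
move=> [Xp]; rewrite subGE// lee_fin => Gp minp; split => // y Xy Gy.
by have := minp y Xy; rewrite subGE// !subFE// !lee_fin; exact.
Qed.

End Subproblem.

(** * Rounding up iteration counts *)

Section Ceil.
Context {R : realType}.
Implicit Types a e : R.

Lemma ge_absz_ceil a : a <= `|Num.ceil a|%N%:R.
Proof.
apply: le_trans (ceil_ge a) _.
by rewrite natr_absz ler_int ler_norm.
Qed.

Lemma absz_ceil_le a : 0 <= a -> `|Num.ceil a|%N%:R <= a + 1.
Proof.
move=> a0; rewrite natr_absz ger0_norm; last by rewrite ceil_ge0 (lt_le_trans _ a0)// ltrN10.
have := ceilB1_lt a; rewrite intrB; lra.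
Qed.

Lemma absz_ceil_div_sqr_le a e : 0 <= a -> 0 < e <= 1 ->
  `|Num.ceil (a / e ^+ 2)|%N%:R <= (a + 1) / e ^+ 2.
Proof.
move=> a0 /andP[e0 e1]; apply: le_trans (absz_ceil_le _) _.
  by rewrite divr_ge0 ?sqr_ge0.
by rewrite mulrDl lerD2l mul1r invf_ge1 ?exprn_gt0// exprn_ile1// ltW.
Qed.

End Ceil.

(** * The oracle property and the multiplier of the subproblem *)

Section Oracle.
Context {R : realType} {d m : nat}.
Variables (X : set 'rV[R]_d) (f : 'I_m.+1 -> 'rV[R]_d -> \bar R).
Variables (eps rho rhoeps sigma M D flb : R) (xfeas : 'rV[R]_d).
Hypothesis A : assumptions X f eps rho rhoeps sigma M D flb xfeas.
Implicit Types x y z : 'rV[R]_d.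

Lemma M_ge0 : 0 <= M.
Proof.
have [Xx _] := xfeas_feasible A; have [zeta hz] := f_subdiff_neq0 A ord0 Xx.
by apply: le_trans (enorm_ge0 zeta) _; exact: (subgrad_bound A) hz.
Qed.

Lemma D_ge0 : 0 <= D.
Proof.
have [Xx _] := xfeas_feasible A.
exact: le_trans (enorm_ge0 _) (X_diam A Xx Xx).
Qed.

Variables (rhohat : R) (xt : 'rV[R]_d).
Hypotheses (hrho : rho < rhohat) (Xxt : X xt).

Local Notation F := (realF f rhohat xt).
Local Notation G := (realG f rhohat xt).

Lemma rhohat_gt0 : 0 < rhohat.
Proof. exact: le_lt_trans (rho_ge0 A) hrho. Qed.

Let mu0 : 0 < rhohat - rho. Proof. by rewrite subr_gt0. Qed.

Section SwitchingRun.
Hypothesis hMD : 0 < M \/ 0 < D.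
Variables (e : R) (z : nat -> 'rV[R]_d).
Hypotheses (e0 : 0 < e) (run : ssm_run X f rho rhohat M D xt e z).
Hypothesis feas : sub_feasible X f rhohat xt.
Let K := ssm_K rho rhohat M D e.

(** With M = D = 0 there would be no iteration, and [ssm_out] would be the zero vector, which may
    lie outside [X]. *)
Lemma ssm_K_gt0 : (0 < K)%N.
Proof.
rewrite -(ltr_nat R); apply: lt_le_trans (ge_absz_ceil _).
rewrite divr_gt0 ?mulr_gt0 ?exprn_gt0//.
case: hMD => [M0|D0].
  by rewrite ltr_pwDl ?exprn_gt0// mulr_ge0 ?sqr_ge0.
by rewrite ltr_wpDl ?sqr_ge0// mulr_gt0 ?exprn_gt0 ?rhohat_gt0.
Qed.

(** The factor 4 in K becomes 2 through (a + b)^2 <= 2 (a^2 + b^2). *)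
Lemma ssm_K_ge : 2 * (M + rhohat * D) ^+ 2 <= (rhohat - rho) * e ^+ 2 * K%:R.
Proof.
have /= := ge_absz_ceil (4 * (M ^+ 2 + rhohat ^+ 2 * D ^+ 2) / ((rhohat - rho) * e ^+ 2)).
rewrite ler_pdivrMr ?mulr_gt0 ?exprn_gt0// -/(ssm_K rho rhohat M D e) -/K.
have := sqr_ge0 (M - rhohat * D); lra.
Qed.

Lemma ssm_mem k : (k <= K)%N -> X (z k).
Proof.
have [z0 step] := run; case: k => [_|k /step[zeta _ ->]]; first by rewrite z0.
by have [] := projP (X_compact A) (ex_intro _ xt Xxt) (z k - ssm_step rho rhohat k *: zeta).
Qed.

Lemma ssm_IE k : (k < K)%N -> ssm_I f rhohat xt e z k = (G (z k) <= e ^+ 2).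
Proof. by move=> /ltnW/ssm_mem Xz; rewrite /ssm_I (subGE A). Qed.

Lemma ssm_spec (y := ssm_out f rho rhohat M D xt e z) :
  [/\ exists2 k, (k < K)%N & ssm_I f rhohat xt e z k, X y,
      F y - F (xhat X f rhohat xt) <= e ^+ 2 & G y <= e ^+ 2].
Proof.
have [Xp Gp _] := xhatP A hrho Xxt feas; have [z0 step] := run.
have Xz0 : X (z 0) by rewrite z0.
have z_step k : (k < K)%N -> exists2 zeta, enorm zeta <= M + rhohat * D /\
    supports (rhohat - rho) X (if G (z k) <= e ^+ 2 then F else G) (z k) zeta &
    z k.+1 = proj X (z k - (2 / ((rhohat - rho) * k.+2%:R)) *: zeta).
  move=> kK; have Xz := ssm_mem (ltnW kK).
  have [zeta sz zE] := step k kK; exists zeta => //; move: sz; rewrite ssm_IE//.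
  case: ifP => _.
    move=> hz; split.
      have := subdiff_add_quad hz => /(sub_subgrad_bound A hrho Xxt Xz).
      by rewrite subrK.
    exact: (subdiff_supports (ltW mu0) (X_convex A) (subF_strongly_convex A hrho Xxt)
      (fun y Xy => subFE A rhohat xt Xy) Xz hz).
  move=> [hz zL]; split=> //.
  exact: (subdiff_supports (ltW mu0) (X_convex A) (subG_strongly_convex A rhohat xt)
      (fun y Xy => subGE A rhohat xt Xy) Xz hz).
have [[k kK Gk] Xy Fy Gy] := switching_mean (X_convex A) (X_compact A) mu0
  (subF_strongly_convex A hrho Xxt) (subG_strongly_convex A rhohat xt) Xp Gp Xz0 z_step
  (exprn_gt0 2 e0) ssm_K_gt0 ssm_K_ge.
have yE : y = (\sum_(k < K | G (z k) <= e ^+ 2) k.+1%:R : R)^-1 *: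
    \sum_(k < K | G (z k) <= e ^+ 2) k.+1%:R *: z k.
  by rewrite /y /ssm_out; congr (_^-1 *: _); apply: eq_bigl => i; rewrite ssm_IE.
split; rewrite ?yE//.
by exists k => //; rewrite ssm_IE.
Qed.

End SwitchingRun.

Lemma prox_multiplier (p := xhat X f rhohat xt) :
  rhohat <= rho + rhoeps -> eps_feasible X f (eps ^+ 2) xt ->
  sub_feasible X f rhohat xt /\ exists c, [/\ 0 <= c,
    c * (1 + c) * (2 * sigma * (rhohat - rho)) <= (M + rhohat * D) ^+ 2 &
    forall y, X y -> F p + (1 + c) * (rhohat - rho) / 2 * enorm (y - p) ^+ 2 <=
      F y + c * G y].
Proof.
move=> hr /(slater A)/ereal_inf_lt[_ [s Xs <-]].
rewrite /add_quad -(fineK (constr_fin_num A Xs)) -EFinD lte_fin => Gs.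
(* This is where [rhohat <= rho + rhoeps] enters. *)
have {}Gs : G s < - sigma.
  apply: le_lt_trans Gs; rewrite (G_fine A)// lerD2l ler_wpM2r ?sqr_ge0//.
  by rewrite ler_pM2r// invr_gt0.
have s0 := sigma_gt0 A.
have Gs0 : G s < 0 by lra.
have feas : sub_feasible X f rhohat xt.
  by apply/(sub_feasibleP A); exists s => //; exact: ltW.
split => //; have [Xp Gp minp] := xhatP A hrho Xxt feas; rewrite -/p in Xp Gp minp.
have scF := subF_strongly_convex A hrho Xxt.
have scG := subG_strongly_convex A rhohat xt.
have [c c0 hc] := lagrange_multiplier (ltW mu0) (X_convex A) scF scG Xp Gp minp Xs Gs0.
(* Complementary slackness, from the multiplier inequality at p itself. *)
have cG : c * G p = 0.
  by apply/eqP; rewrite eq_le mulr_ge0_le0//=; have := hc _ Xp; lra.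
have hmin y : X y ->
    F p + (1 + c) * (rhohat - rho) / 2 * enorm (y - p) ^+ 2 <= F y + c * G y.
  move=> Xy; have := strongly_convex_min (X_convex A) (strongly_convexD c0 scF scG)
    Xp _ Xy; rewrite cG addr0; exact.
exists c; split=> //.
(* The growth inequality at the Slater point s, with F s - F p bounded by the Lipschitz estimate. *)
apply: (@multiplier_bound _ _ _ _ _ (enorm (s - p))) => //.
have := subF_lipschitz A hrho Xxt Xp Xs; have := hmin _ Xs.
by have := ler_wpM2l c0 (ltW Gs); lra.
Qed.

End Oracle.

(** * The IQRC method *)

Lemma subgrad_bound_gt0 {R : realType} (M D a : R) :
  0 <= M -> 0 <= D -> 0 < a -> 0 < M \/ 0 < D -> 0 < M + a * D.
Proof.
move=> M0 D0 a0 [Mp|Dp]; first by rewrite ltr_pwDl// mulr_ge0// ltW.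
by rewrite ltr_wpDl// mulr_gt0.
Qed.

(** * Constants of the method and the iteration count *)

Section Constants.
Context {R : realType}.
Variables (rho rhohat M D sigma : R).
Hypotheses (hrho : rho < rhohat) (s0 : 0 < sigma) (L0 : 0 < M + rhohat * D).

(** The term added to 1 inside [epshat]. *)
Definition mult_bound := (M + rhohat * D) / Num.sqrt (2 * sigma * (rhohat - rho)).

(* The Slater argument bounds a multiplier c by c * (1 + c) <= mult_bound ^+ 2,
   which is strictly better than c <= mult_bound; the gain pays for the initial
   point being only eps ^+ 2-feasible. *)
Definition sharp_mult_bound := 2 * mult_bound ^+ 2 / (2 * mult_bound + 1).

Let mu0 : 0 < rhohat - rho. Proof. by rewrite subr_gt0. Qed.
Let smu0 : 0 < 2 * sigma * (rhohat - rho). Proof. by rewrite !mulr_gt0. Qed.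

Lemma mult_bound_gt0 : 0 < mult_bound.
Proof. by rewrite divr_gt0// sqrtr_gt0. Qed.

Lemma sharp_mult_bound_gt0 : 0 < sharp_mult_bound.
Proof.
have h := mult_bound_gt0; apply: divr_gt0.
  by rewrite mulr_gt0// exprn_gt0.
by rewrite addr_gt0// mulr_gt0.
Qed.

Lemma sharp_mult_bound_lt : sharp_mult_bound < mult_bound.
Proof.
have h := mult_bound_gt0; rewrite ltr_pdivrMr; last by rewrite addr_gt0// mulr_gt0.
lra.
Qed.

(** With B = [mult_bound], replace c^2 by its tangent 2 B c - B^2 in c + c^2 <= B^2. *)
Lemma le_sharp_mult_bound c :
  c * (1 + c) * (2 * sigma * (rhohat - rho)) <= (M + rhohat * D) ^+ 2 ->
  c <= sharp_mult_bound.
Proof.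
have h := mult_bound_gt0; rewrite -ler_pdivlMr//.
have -> : (M + rhohat * D) ^+ 2 / (2 * sigma * (rhohat - rho)) = mult_bound ^+ 2.
  by rewrite expr_div_n sqr_sqrtr// ltW.
move=> hc; rewrite ler_pdivlMr; last by rewrite addr_gt0// mulr_gt0.
by have := sqr_ge0 (c - mult_bound); lra.
Qed.

Definition epshat_factor := epshat rho rhohat M D sigma 1.

Lemma epshatE eps : epshat rho rhohat M D sigma eps = epshat_factor * eps.
Proof. by rewrite /epshat_factor /epshat mulr1. Qed.

Lemma epshat_factor_gt0 : 0 < epshat_factor.
Proof.
rewrite /epshat_factor /epshat mulr1 lt_min ltr01/= mulr_gt0 ?invr_gt0 ?sqrtr_gt0//.
  by rewrite divr_gt0.
by rewrite ltr_pwDr// ltW// mult_bound_gt0.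
Qed.

Lemma epshat_factor_le1 : epshat_factor <= 1.
Proof. by rewrite /epshat_factor /epshat mulr1 ge_min lexx. Qed.

(** Keeps the error per outer iteration, (B + 1) ehat^2 with B = [mult_bound], within mu eps^2 /
    4. *)
Lemma epshat_factor_sqr : (mult_bound + 1) * epshat_factor ^+ 2 <= (rhohat - rho) / 4.
Proof.
have b1 : 0 < mult_bound + 1 by rewrite addr_gt0// mult_bound_gt0.
have m4 : 0 <= (rhohat - rho) / 4 by rewrite divr_ge0// ltW.
rewrite mulrC -ler_pdivlMr// -[leRHS]sqr_sqrtr; last by rewrite divr_ge0// ltW.
rewrite ler_sqr ?nnegrE ?sqrtr_ge0 ?(ltW epshat_factor_gt0)//.
rewrite sqrtrM// sqrtrV ?(ltW b1)//.
by rewrite /epshat_factor /epshat mulr1 ge_min lexx orbT.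
Qed.

Lemma iqrc_T_ge Delta eps : 0 < eps ->
  4 * Delta <= eps ^+ 2 * (rhohat - rho) * (iqrc_T rho rhohat Delta eps)%:R.
Proof.
move=> e0; rewrite [leRHS]mulrC -ler_pdivrMr ?mulr_gt0 ?exprn_gt0//.
by apply: le_trans (ge_absz_ceil _) _; rewrite ler_nat leq_maxr.
Qed.

Lemma iqrc_complexity_le Delta eps : 0 <= Delta -> 0 < eps <= 1 ->
  (iqrc_complexity rho rhohat M D sigma Delta eps)%:R <=
    (4 * Delta / (rhohat - rho) + 1) *
    (4 * (M ^+ 2 + rhohat ^+ 2 * D ^+ 2) / ((rhohat - rho) * epshat_factor ^+ 2) + 1)
    / eps ^+ 4.
Proof.
move=> D0 /andP[e0 e1]; have c0 := epshat_factor_gt0.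
have e01 : 0 < eps <= 1 by rewrite e0.
set a := 4 * Delta / _; set b := 4 * _ / _.
have -> : (a + 1) * (b + 1) / eps ^+ 4 =
    (a + 1) / eps ^+ 2 * ((b + 1) / eps ^+ 2) by rewrite mulrACA -invfM -exprD.
rewrite natrM.
have e2 : eps ^+ 2 <= 1 := exprn_ile1 2 (ltW e0) e1.
apply: ler_pM => //.
  have a0 : 0 <= a by rewrite divr_ge0 ?mulr_ge0// ltW.
  (* The lower bound 1 on T is covered by eps^2 <= 1 <= a + 1. *)
  rewrite natr_max ge_max ler_pdivlMr ?exprn_gt0// mul1r (le_trans e2) ?lerDr//=.
  rewrite (_ : _ / (eps ^+ 2 * _) = a / eps ^+ 2); first exact: absz_ceil_div_sqr_le.
  by rewrite /a -mulrA -invfM (mulrC (eps ^+ 2)).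
have b0 : 0 <= b.
  apply: divr_ge0; last by rewrite mulr_ge0 ?sqr_ge0// ltW.
  by rewrite mulr_ge0// addr_ge0 ?sqr_ge0// mulr_ge0 ?sqr_ge0.
rewrite /ssm_K epshatE exprMn (_ : _ / (_ * _) = b / eps ^+ 2).
  exact: absz_ceil_div_sqr_le.
by rewrite /b -[RHS]mulrA -invfM (mulrA (rhohat - rho)).
Qed.

End Constants.

(** * Descent over the outer iterations *)

Section IQRC.
Context {R : realType} {d m : nat}.
Variables (X : set 'rV[R]_d) (f : 'I_m.+1 -> 'rV[R]_d -> \bar R).
Variables (eps rho rhoeps sigma M D flb : R) (x0 : 'rV[R]_d).
Hypothesis A : assumptions X f eps rho rhoeps sigma M D flb x0.
Variable rhohat : R.
Hypotheses (hrho : rho < rhohat) (hMD : 0 < M \/ 0 < D).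
Hypothesis hr : rhohat <= rho + rhoeps.

Let L0 : 0 < M + rhohat * D.
Proof.
exact: subgrad_bound_gt0 (M_ge0 A) (D_ge0 A) (rhohat_gt0 A hrho) hMD.
Qed.

(** The growth inequality of the Lagrangian is taken at [xt], where the proximal terms vanish and
    the constraint costs at most c b. Feasibility at level eps^2 serves the Slater condition, the
    level b measures the error. *)
Lemma prox_descent xt y b h (p := xhat X f rhohat xt) :
  X xt -> X y -> eps_feasible X f (eps ^+ 2) xt -> eps_feasible X f b xt -> 0 <= b ->
  realF f rhohat xt y - realF f rhohat xt p <= h ->
  (rhohat - rho) / 2 * enorm (xt - p) ^+ 2 <=
    fine (obj f xt) - fine (obj f y) + sharp_mult_bound rho rhohat M D sigma * b + h.
Proof.
move=> Xxt Xy feas [_ gb] b0 Fy.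
have [sf [c [c0 cb cmin]]] := prox_multiplier A hrho Xxt hr feas.
have cs := le_sharp_mult_bound hrho (sigma_gt0 A) L0 cb.
have := cmin _ Xxt; rewrite (F_fine A _ _ Xxt) (G_fine A _ _ Xxt).
rewrite subrr enorm0 expr0n/= mulr0 !addr0.
have {}gb : fine (constr f xt) <= b.
  by move: gb; rewrite -(fineK (constr_fin_num A Xxt)) lee_fin.
have h1 := le_trans (ler_wpM2l c0 gb) (ler_wpM2r b0 cs).
have r0 := rhohat_gt0 A hrho.
have h2 : 0 <= rhohat / 2 * enorm (y - xt) ^+ 2.
  by rewrite mulr_ge0 ?sqr_ge0// divr_ge0// ltW.
have h3 : 0 <= c * ((rhohat - rho) / 2 * enorm (xt - p) ^+ 2).
  by rewrite mulr_ge0// mulr_ge0 ?sqr_ge0// divr_ge0// subr_ge0 ltW.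
by move: Fy; rewrite (F_fine A _ _ Xy) -/p; lra.
Qed.

Variables (T : nat) (x : nat -> 'rV[R]_d) (b : R).
Let eh := epshat rho rhohat M D sigma eps.
Let s := sharp_mult_bound rho rhohat M D sigma.
Hypothesis run : iqrc_ssm_run rho rhohat M D sigma X f x0 T eps x.
Hypotheses (b_ge : eh ^+ 2 <= b) (b_le : b <= eps ^+ 2) (x0b : eps_feasible X f b x0).

Lemma epshat_gt0 : 0 < eh.
Proof.
rewrite /eh epshatE mulr_gt0// ?(eps_gt0 A)//.
exact: epshat_factor_gt0 hrho (sigma_gt0 A) L0.
Qed.

Lemma eps_feasibleW a c y : a <= c -> eps_feasible X f a y -> eps_feasible X f c y.
Proof. by move=> ac [Xy gy]; split=> //; apply: le_trans gy _; rewrite lee_fin. Qed.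

Lemma iqrc_step t : (t < T)%N -> eps_feasible X f (eps ^+ 2) (x t) ->
  eps_feasible X f (eh ^+ 2) (x t.+1) /\
  realF f rhohat (x t) (x t.+1) - realF f rhohat (x t) (xhat X f rhohat (x t)) <= eh ^+ 2.
Proof.
move=> tT feas; have [_ /(_ t tT)[z zrun ->]] := run.
have Xt := feas.1; have [sf _] := prox_multiplier A hrho Xt hr feas.
have [_ Xy Fy Gy] := ssm_spec A hrho Xt hMD epshat_gt0 zrun sf.
split=> //; split=> //; rewrite -(fineK (constr_fin_num A Xy)) lee_fin.
apply: le_trans Gy; rewrite (G_fine A)// lerDl mulr_ge0 ?sqr_ge0//.
by rewrite divr_ge0// ltW// (rhohat_gt0 A).
Qed.

Lemma iqrc_feasible t : (t <= T)%N ->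
  eps_feasible X f (if t == 0%N then b else eh ^+ 2) (x t).
Proof.
elim: t => [_|t ih tT]; first by rewrite run.1.
have [] := iqrc_step tT _ => //; apply: eps_feasibleW (ih (ltnW tT)).
by case: ifP => // _; exact: le_trans b_ge b_le.
Qed.

(** Every step is charged s ehat^2 for infeasibility, except the first, charged s b; the difference
    stays as a separate term. *)
Lemma iqrc_sum_le n : (n < T)%N ->
  (rhohat - rho) / 2 * \sum_(t < n.+1) enorm (x t - xhat X f rhohat (x t)) ^+ 2 <=
    fine (obj f x0) - fine (obj f (x n.+1)) + s * (b - eh ^+ 2) +
    n.+1%:R * ((s + 1) * eh ^+ 2).
Proof.
have e2 : 0 <= eh ^+ 2 by exact: sqr_ge0.
have step t : (t < T)%N ->
    (rhohat - rho) / 2 * enorm (x t - xhat X f rhohat (x t)) ^+ 2 <=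
    fine (obj f (x t)) - fine (obj f (x t.+1)) +
    s * (if t == 0%N then b else eh ^+ 2) + eh ^+ 2.
  move=> tT; have ft := iqrc_feasible (ltnW tT).
  have ft' : eps_feasible X f (eps ^+ 2) (x t).
    by apply: eps_feasibleW ft; case: ifP => // _; exact: le_trans b_ge b_le.
  have [[Xy _] Fy] := iqrc_step tT ft'.
  apply: prox_descent => //; first exact: ft.1.
  by case: ifP => // _; exact: le_trans e2 b_ge.
elim: n => [T0|n ih nT].
  by rewrite big_ord1; have := step 0%N T0; rewrite /= run.1; lra.
rewrite big_ord_recr/= mulrDr; have := ih (ltnW nT); have := step _ nT.
rewrite /= -(natr1 n.+1); lra.
Qed.

(** The third hypothesis pays for the excess of the first step by raising s to [mult_bound] in all T
    error terms. These then sum to at most T mu eps^2 / 4, and so does the total decrease of f by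
    the choice of T. *)
Lemma iqrc_mean_le Delta : T = iqrc_T rho rhohat Delta eps ->
  obj f x0 = (flb + Delta)%:E ->
  s * (b - eh ^+ 2) <= T%:R * (mult_bound rho rhohat M D sigma - s) * eh ^+ 2 ->
  expect_unif T (fun t => enorm (x t - xhat X f rhohat (x t)) ^+ 2) <= eps ^+ 2.
Proof.
move=> TE x0E slack; have Tgt0 : (0 < T)%N by rewrite TE leq_max.
have mu0 : 0 < rhohat - rho by rewrite subr_gt0.
have flbT : flb <= fine (obj f (x T)).
  have [XT _] := iqrc_feasible (leqnn T).
  have fT : obj f (x T) \is a fin_num := f_fin_num A ord0 XT.
  by rewrite -lee_fin (fineK fT); exact: flb_lower A _ XT.
have TD : 4 * Delta <= eps ^+ 2 * (rhohat - rho) * T%:R.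
  by rewrite TE; exact: iqrc_T_ge hrho _ _ (eps_gt0 A).
have ehT : T%:R * ((mult_bound rho rhohat M D sigma + 1) * eh ^+ 2) <=
    T%:R * ((rhohat - rho) / 4 * eps ^+ 2).
  rewrite ler_wpM2l// /eh epshatE exprMn mulrA ler_wpM2r ?sqr_ge0//.
  exact: epshat_factor_sqr hrho (sigma_gt0 A) L0.
rewrite /expect_unif ler_pdivrMr ?ltr0n//.
rewrite -(ler_pM2l (divr_gt0 mu0 (ltr0Sn R 1))).
(* [iqrc_sum_le] at index n sums n + 1 steps. *)
move: Tgt0 (iqrc_sum_le (n := T.-1)); case: (T) flbT TD ehT slack => //= n.
move=> flbT TD ehT slack _ /(_ (leqnn _)); rewrite x0E /=.
lra.
Qed.

End IQRC.

(** In (ii) the constants precede the dimension and the problem, which makes the O uniform. For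
    Delta = 0 there is a single outer iteration, so the excess error of x_0 cannot be averaged out;
    accuracy is then claimed from an ehat^2-feasible start. *)
Theorem theorem2 (R : realType) (rho rhohat M D sigma : R)
    (hrho : rho < rhohat) (hMD : 0 < M \/ 0 < D) :
  (* (i) *)
  (forall (d m : nat) (X : set 'rV[R]_d) (f : 'I_m.+1 -> 'rV[R]_d -> \bar R)
     (eps rhoeps flb : R) (xfeas : 'rV[R]_d),
   assumptions X f eps rho rhoeps sigma M D flb xfeas ->
     (forall (e : R) (xt : 'rV[R]_d) (z : nat -> 'rV[R]_d),
        0 < e -> X xt -> sub_feasible X f rhohat xt ->
        ssm_run X f rho rhohat M D xt e z ->
        let y := ssm_out f rho rhohat M D xt e z in
        [/\ exists2 k, (k < ssm_K rho rhohat M D e)%N & ssm_I f rhohat xt e z k,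
            X y,
            (subF f rhohat xt y - subF f rhohat xt (xhat X f rhohat xt)
               <= (e ^+ 2)%:E)%E &
            (subG f rhohat xt y <= (e ^+ 2)%:E)%E]) /\
     (forall (dO : measure_display) (Omega : measurableType dO)
        (P : probability Omega R) (A : 'rV[R]_d -> R -> R -> Omega -> 'rV[R]_d),
        (forall (xt : 'rV[R]_d) (e delta : R) (w : Omega),
           0 < e -> 0 < delta < 1 -> X xt -> sub_feasible X f rhohat xt ->
           ssm_output X f rho rhohat M D xt e (A xt e delta w)) ->
        is_oracle X f P rhohat A)) /\
  (* (ii) *)
  (forall Delta : R,
   exists C eps0 : R, [/\ 0 < C, 0 < eps0 &
   forall (d m : nat) (X : set 'rV[R]_d) (f : 'I_m.+1 -> 'rV[R]_d -> \bar R)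
     (eps rhoeps flb : R) (x0 : 'rV[R]_d) (x : nat -> 'rV[R]_d),
     let T := iqrc_T rho rhohat Delta eps in
     let Edist2 := expect_unif T
       (fun t => enorm (x t - xhat X f rhohat (x t)) ^+ 2) in
     assumptions X f eps rho rhoeps sigma M D flb x0 ->
     rhohat <= rho + rhoeps ->
     obj f x0 = (flb + Delta)%:E ->
     iqrc_ssm_run rho rhohat M D sigma X f x0 T eps x ->
     [/\ eps <= eps0 ->
           (iqrc_complexity rho rhohat M D sigma Delta eps)%:R <= C / eps ^+ 4,
         0 < Delta -> eps <= eps0 -> Edist2 <= eps ^+ 2 &
         eps_feasible X f (epshat rho rhohat M D sigma eps ^+ 2) x0 ->
           Edist2 <= eps ^+ 2]]).
Proof.
have mu0 : 0 < rhohat - rho by rewrite subr_gt0.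
split=> [d m X f eps rhoeps flb xfeas A|Delta].
  have spec e xt z (e0 : 0 < e) (Xxt : X xt) (feas : sub_feasible X f rhohat xt)
      (run : ssm_run X f rho rhohat M D xt e z) :
      let y := ssm_out f rho rhohat M D xt e z in
      [/\ exists2 k, (k < ssm_K rho rhohat M D e)%N & ssm_I f rhohat xt e z k,
          X y,
          (subF f rhohat xt y - subF f rhohat xt (xhat X f rhohat xt)
             <= (e ^+ 2)%:E)%E &
          (subG f rhohat xt y <= (e ^+ 2)%:E)%E].
    have [Xp _ _] := xhatP A hrho Xxt feas.
    have [hI Xy Fy Gy] := ssm_spec A hrho Xxt hMD e0 run feas.
    by split; rewrite // ?(subFE A) ?(subGE A)// -?EFinB lee_fin.
  split=> // dO Omega P O hO xt e delta Xxt feas e0 delta01.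
  have good w : X (O xt e delta w) /\ good_output X f rhohat xt e (O xt e delta w).
    have [z run ->] := hO xt e delta w e0 delta01 Xxt feas.
    by have [_ Xy Fy Gy] := spec _ _ _ e0 Xxt feas run.
  split=> [w|]; first exact: (good w).1.
  exists setT; split => //; first by move=> w _; exact: (good w).2.
  by rewrite probability_setT lee_fin; case/andP: delta01 => d0 _; lra.
(* The constants are produced before any instance is given; parameters admitting no instance are
   dismissed first. *)
have [good|bad] := boolP [&& 0 <= rho, 0 <= M, 0 <= D, 0 < sigma & 0 <= Delta]; last first.
  exists 1, 1; split=> // d m X f eps rhoeps flb x0 x T Edist2 A hr x0E run; exfalso.
  have [Xx0 _] := xfeas_feasible A; have := flb_lower A Xx0.
  rewrite x0E lee_fin lerDl => D0.
  by move: bad; rewrite (rho_ge0 A) (M_ge0 A) (D_ge0 A) (sigma_gt0 A) D0.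
case/and5P: good => rho0 M0 D0 s0 Delta0.
have rh0 : 0 < rhohat by exact: le_lt_trans hrho.
have L0 := subgrad_bound_gt0 M0 D0 rh0 hMD.
pose s := sharp_mult_bound rho rhohat M D sigma.
pose gap := mult_bound rho rhohat M D sigma - s.
pose c := epshat_factor rho rhohat M D sigma.
have gap0 : 0 < gap by rewrite subr_gt0; exact: sharp_mult_bound_lt.
have sp : 0 < s by exact: sharp_mult_bound_gt0.
have c0 : 0 < c by exact: epshat_factor_gt0.
(* For eps <= 1, T >= 4 Delta / (eps mu), so eps <= kappa yields s <= T gap c^2, the slack needed
   when b = eps^2. *)
pose kappa := 4 * Delta * (gap * c ^+ 2) / ((rhohat - rho) * s).
exists ((4 * Delta / (rhohat - rho) + 1) *
    (4 * (M ^+ 2 + rhohat ^+ 2 * D ^+ 2) / ((rhohat - rho) * c ^+ 2) + 1)).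
exists (if 0 < Delta then Num.min 1 kappa else 1).
have eps0_le1 : (if 0 < Delta then Num.min 1 kappa else 1) <= 1.
  by case: ifP => // _; rewrite ge_min lexx.
split.
- apply: mulr_gt0; rewrite ltr_wpDl//; apply: divr_ge0.
  + exact: mulr_ge0.
  + exact: ltW.
  + by rewrite mulr_ge0// addr_ge0 ?sqr_ge0// mulr_ge0 ?sqr_ge0.
  + by rewrite mulr_ge0 ?sqr_ge0// ltW.
- case: ifP => // Dp; rewrite lt_min ltr01/=; apply: divr_gt0; last exact: mulr_gt0.
  by apply: mulr_gt0; [exact: mulr_gt0|rewrite mulr_gt0 ?exprn_gt0].
move=> d m X f eps rhoeps flb x0 x T Edist2 A hr x0E run.
have e0 := eps_gt0 A; have ehE := epshatE rho rhohat M D sigma eps; rewrite -/c in ehE.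
have eh_le : epshat rho rhohat M D sigma eps ^+ 2 <= eps ^+ 2.
  by rewrite ehE exprMn ler_piMl ?sqr_ge0// exprn_ile1 ?(ltW c0)// epshat_factor_le1.
split=> [eps_le|Dp eps_le|x0f].
- by apply: iqrc_complexity_le => //; rewrite e0 (le_trans eps_le).
- apply: (iqrc_mean_le A hrho hMD hr run eh_le (lexx _) (xfeas_feasible A) erefl x0E).
  have e1 : eps <= 1 by exact: le_trans eps_le eps0_le1.
  rewrite -/s -/gap -/T; apply: (@le_trans _ _ (s * eps ^+ 2)).
    by rewrite ler_wpM2l ?(ltW sp)// gerBl sqr_ge0.
  rewrite ehE exprMn [leRHS]mulrA ler_wpM2r ?sqr_ge0//.
  have he : eps * ((rhohat - rho) * s) <= 4 * Delta * (gap * c ^+ 2).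
    move: eps_le; rewrite Dp le_min => /andP[_].
    by rewrite ler_pdivlMr// mulr_gt0.
  have := iqrc_T_ge hrho Delta e0; rewrite -/T => hT.
  have gc0 : 0 <= gap * c ^+ 2 by rewrite mulr_ge0 ?sqr_ge0// ltW.
  have := le_trans he (ler_wpM2r gc0 hT) => {}hT.
  have ms0 : 0 <= (rhohat - rho) * s by rewrite mulr_ge0// ltW.
  have ee : eps ^+ 2 <= eps by rewrite expr2 ler_piMl// ltW.
  have := le_trans (ler_wpM2r ms0 ee) hT => {}hT.
  have em : 0 < eps ^+ 2 * (rhohat - rho) by rewrite mulr_gt0 ?exprn_gt0.
  rewrite -(ler_pM2l em); lra.
(* With b = ehat^2 the first step has no excess to pay for. *)
- apply: (iqrc_mean_le A hrho hMD hr run (lexx _) eh_le x0f erefl x0E).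
  rewrite subrr mulr0 -/s -/gap; apply: mulr_ge0; last exact: sqr_ge0.
  by rewrite mulr_ge0// ltW.
Qed.
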